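(* Let $G,\Omega,\Sigma=\{\Delta_1,\dots,\Delta_s\},\Delta=\Delta_1,L,M,M_i,R,B_A$ be as in the context. Let $X:=G^{(2),\Omega}$ and $Y:=X_\Delta^\Delta$ (the permutation group induced on $\Delta$ by the setwise stabiliser $X_\Delta$), and suppose that $L=L^{(2),\Sigma}$. (1) If $|\Delta|=2$, so $R=M^\Delta=\mathbb{Z}/2\mathbb{Z}$ (written additively), then the following are equivalent: (i) $X\ne G$ (that is, $G^\Omega$ is not $2$-closed); (ii) for all $i,j\le s$, $(M_i\cap M_j)G_{\alpha_i}=M_i$, where $\alpha_i\in\Delta_i$; (iii) the element $z=(1,1,\dots,1)$ in the base group $B_R=R^s$ of $R\wr L=B_R\rtimes L$ lies in $X$. (2) If $X\ne G$, then $X=N\rtimes G$ with $N$ a subdirect subgroup of a base group $B_A$ for some nontrivial $A\unlhd Y$, and all $A$-orbits in $\Delta$ have the same length, say $a$, where $a$ divides $|L_{ij}|$ for all distinct $i,j\le s$ (where $L_{ij}$ is the stabiliser in $L$ of $\Delta_i$ and $\Delta_j$). (3) If $L$ has base size $2$, then $X=G$. (4) Suppose that $|\Delta|=p$, where $p$ is prime, so that $R=M^\Delta=\mathbb{Z}/p\mathbb{Z}$. Suppose also that $X\ne G$ (that is, $G^\Omega$ is not $2$-closed). Then for all $i,j\le s$, and all $\alpha_i\in\Delta_i$, we have $(M_i\cap M_j)G_{\alpha_i}=M_i$.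
   Context: For $P\le\mathrm{Sym}(\Gamma)$, $P^{(2),\Gamma}$ denotes the $2$-closure: all $g\in\mathrm{Sym}(\Gamma)$ leaving invariant each $P$-orbit on $\Gamma\times\Gamma$. If $P$ acts on $\Gamma$, $P^\Gamma$ is the induced permutation group. The base size of a finite transitive permutation group is the minimum size of a set of points whose pointwise stabiliser is trivial; the base size of $L$ refers to its action on $\Sigma$. A subgroup of a direct product is subdirect if it projects onto each direct factor. Setting. $G$ is a finite group acting faithfully, transitively and imprimitively on a finite set $\Omega$; $\Sigma=\{\Delta_1,\dots,\Delta_s\}$ is a nontrivial $G$-invariant partition of $\Omega$, $1<s<|\Omega|$; $L=G^\Sigma\le\mathrm{Sym}(\Sigma)$; $\Delta=\Delta_1$; $M=G_\Delta$ is the setwise stabiliser of $\Delta$, and $M_i$ is the setwise stabiliser of $\Delta_i$ in $G$; $G_\alpha$ is the stabiliser of the point $\alpha\in\Omega$; $R=M^\Delta\le\mathrm{Sym}(\Delta)$. It is assumed that $M$ is core-free in $G$ (equivalently $G$ acts faithfully on $\Sigma$, so $G\cong L$). By the imprimitive wreath embedding theorem, identify $\Sigma$ with $\{1,\dots,s\}$, $\Omega$ with $\Delta\times\{1,\dots,s\}$ and $\Delta_i$ with $\Delta\times\{i\}$ so that $G\le R\wr L=B_R\rtimes L$, where $B_R=R^s$, and $(x_1,\dots,x_s)\in B_R$ and $\sigma\in L$ act by $(\delta,i)^{(x_1,\dots,x_s)}=(\delta^{x_i},i)$ and $(\delta,i)^\sigma=(\delta,i^\sigma)$. For any $A\le\mathrm{Sym}(\Delta)$,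 $B_A=A^s$ denotes the naturally embedded base group in $\mathrm{Sym}(\Delta)\wr\mathrm{Sym}(s)$. *)

(* Defs.v *)
From HB Require Import structures.
From mathcomp Require Import all_boot all_order all_algebra all_fingroup all_solvable.

Set Implicit Arguments.
Unset Strict Implicit.
Unset Printing Implicit Defensive.

Import GroupScope.

Section PermutationGroups.

Variable T : finType.

Definition pair_perm (u : T * T) (g : {perm T}) : T * T := (g u.1, g u.2).

Lemma pair_perm1 : pair_perm^~ 1 =1 id.
Proof. by case=> x y; rewrite /pair_perm !perm1. Qed.

Lemma pair_permM u : act_morph pair_perm u.
Proof. by move=> g h; rewrite /pair_perm !permM. Qed.

Canonical pair_action := TotalAction pair_perm1 pair_permM.

Definition two_closure (P : {group {perm T}}) : {group {perm T}} :=
  (\bigcap_(u : T * T) 'N(orbit pair_action P u | pair_action))%G.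

(* The whole of T is a base of any permutation group on T. *)
Definition base_size (P : {group {perm T}}) : nat :=
  #|[arg min_(B < [set: T] | 'C_P(B | 'P) == 1) #|B|]|.

End PermutationGroups.

(* The permutation group induced on S by a group H leaving S invariant
   (elements of H that do not preserve S are discarded). *)
Definition induced (aT : finGroupType) (rT : finType) (to : {action aT &-> rT})
    (S : {set rT}) (H : {group aT}) : {group {perm {x : rT | x \in S}}} :=
  (actperm (to^?)%act @* H)%G.

(* An identification of Omega with Delta x Sigma, where Sigma is a partition
   of Omega and Delta a part: the part A becomes Delta x {A}, and Delta itself
   is identified with Delta x {Delta} by x |-> (x, Delta). *)
Record coordinates (Omega : finType) (Sigma : {set {set Omega}})
    (Delta : {set Omega}) := Coordinates {
  coord_of : Omega -> {x | x \in Delta} * {A | A \in Sigma};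
  of_coord : {x | x \in Delta} * {A | A \in Sigma} -> Omega;
  coord_ofK : cancel coord_of of_coord;
  of_coordK : cancel of_coord coord_of;
  coord_block : forall w, w \in val (coord_of w).2;
  coord_Delta : forall w, w \in Delta -> val (coord_of w).1 = w }.

Section Wreath.

Variables (Omega : finType) (Sigma : {set {set Omega}}) (Delta : {set Omega}).
Variable c : coordinates Sigma Delta.

Local Notation D := {x | x \in Delta}.
Local Notation I := {A | A \in Sigma}.

Definition base_fun (x : {ffun I -> {perm D}}) (w : Omega) : Omega :=
  of_coord c (x (coord_of c w).2 (coord_of c w).1, (coord_of c w).2).

Lemma base_fun_inj x : injective (base_fun x).
Proof.
move=> v w /(can_inj (of_coordK c)) [] /[swap] Ei; rewrite Ei => /perm_inj Ed.
by apply: (can_inj (coord_ofK c)); rewrite [LHS]surjective_pairing Ed Ei -surjective_pairing.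
Qed.

Definition base_elt x : {perm Omega} := perm (@base_fun_inj x).

Definition top_fun (sigma : {perm I}) (w : Omega) : Omega :=
  of_coord c ((coord_of c w).1, sigma (coord_of c w).2).

Lemma top_fun_inj sigma : injective (top_fun sigma).
Proof.
move=> v w /(can_inj (of_coordK c)) [Ed /perm_inj Ei].
by apply: (can_inj (coord_ofK c)); rewrite [LHS]surjective_pairing Ed Ei -surjective_pairing.
Qed.

Definition top_elt sigma : {perm Omega} := perm (@top_fun_inj sigma).

Definition base_group (A : {set {perm D}}) : {set {perm Omega}} :=
  [set base_elt x | x : {ffun I -> {perm D}} in ffun_on (mem A)].

Definition wreath (A : {set {perm D}}) (L : {set {perm I}}) :
    {set {perm Omega}} :=
  base_group A * [set top_elt sigma | sigma in L].

Definition subdirect (N : {set {perm Omega}}) (A : {set {perm D}}) : Prop :=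
  N \subset base_group A /\
  forall i : I, [set x i | x : {ffun I -> {perm D}} & base_elt x \in N] = A.

End Wreath.

(* Main.v *)
Require Import Defs.
From HB Require Import structures.
From mathcomp Require Import all_boot all_order all_algebra all_fingroup all_solvable.

Set Implicit Arguments.
Unset Strict Implicit.
Unset Printing Implicit Defensive.

Import GroupScope.

(* Let N be the kernel of X = G^(2) on Sigma. Every x in X agrees with some g in
   G on any given pair of points, hence on any given pair of blocks, so X acts
   on Sigma inside the 2-closure of L, which is L; as G is faithful on Sigma,
   X = N ><| G. The group N is normal in the transitive group X, so its orbits
   all have the same length a, and a = 1 iff N = 1 iff X = G. If g in G agrees
   with n in N at a point of A and a point of B then g stabilises the blocks A
   and B; hence every orbit of G_{A,B} on A is a union of N-orbits, and a
   divides |G_{A,B}| = |L_{A,B}|. If |Delta| is prime then a = |Delta|, so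
   G_{A,B} is transitive on A, which is the factorisation of M_A. *)

(** * The 2-closure as agreement on pairs of points *)

Lemma two_closureP (T : finType) (P : {group {perm T}}) (x : {perm T}) :
  reflect (forall u v, exists2 g, g \in P & x u = g u /\ x v = g v)
          (x \in two_closure P).
Proof.
apply: (iffP bigcapP) => [cPx u v | cPx [u v] _].
  have := orbit_refl (pair_action T) P (u, v).
  rewrite -(astabs_act _ (cPx (u, v) isT)) => /orbitP[g Pg [<- <-]].
  by exists g.
(* If [g] agrees with [x] on the image of the pair under [h], then [h * g] shows that [x] keeps that
   image in the orbit. *)
rewrite !inE; apply/subsetP=> _ /orbitP[h Ph <-]; rewrite inE /=.
have [g Pg [Eu Ev]] := cPx (h u) (h v).
apply/orbitP; exists (h * g); first exact: groupM.
by rewrite /= /pair_perm /= !permM Eu Ev.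
Qed.

Lemma sub_two_closure (T : finType) (P : {group {perm T}}) :
  P \subset two_closure P.
Proof. by apply/subsetP=> g Pg; apply/two_closureP=> u v; exists g. Qed.

(** * Permutation groups induced on an invariant subset *)

Section Induced.

Variables (aT : finGroupType) (rT : finType) (to : {action aT &-> rT}).
Variable S : {set rT}.
Local Notation sT := {x : rT | x \in S}.
Local Notation rho := (actperm (subaction sT to)).

Lemma subact_dom_astabs : subact_dom (fun x => x \in S) to = 'N(S | to).
Proof.
rewrite /subact_dom; congr ('N(_ | to)).
by apply/setP=> x; rewrite inE.
Qed.

Lemma val_actperm_sub g (u : sT) :
  g \in 'N(S | to) -> val (rho g u) = to (val u) g.
Proof. by move=> nSg; rewrite actpermE /= val_subact subact_dom_astabs nSg. Qed.

Lemma inducedP (H : {group aT}) (r : {perm sT}) :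
  H \subset 'N(S | to) ->
  reflect (exists2 g, g \in H & forall u, val (r u) = to (val u) g)
          (r \in induced to S H).
Proof.
move=> sHN; apply: (iffP morphimP) => [[g _ Hg ->] | [g Hg rE]].
  by exists g => // u; rewrite val_actperm_sub ?(subsetP sHN).
exists g => //; first by rewrite /= subact_dom_astabs (subsetP sHN).
by apply/permP=> u; apply: val_inj; rewrite rE val_actperm_sub ?(subsetP sHN).
Qed.

Lemma mem_induced (H : {group aT}) g :
  H \subset 'N(S | to) -> g \in H -> rho g \in induced to S H.
Proof.
move=> sHN Hg; apply/inducedP=> //; exists g => // u.
by rewrite val_actperm_sub ?(subsetP sHN).
Qed.

Lemma card_orbit_induced (H : {group aT}) (u : sT) :
  H \subset 'N(S | to) -> #|orbit 'P (induced to S H) u| = #|orbit to H (val u)|.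
Proof.
move=> sHN; rewrite -(card_imset _ val_inj); apply: eq_card => y.
apply/imsetP/orbitP => [[_ /orbitP[r /(inducedP _ sHN)[g Hg rE] <-] ->] | [g Hg <-]].
  by exists g; rewrite // -rE.
exists (rho g u); last by rewrite val_actperm_sub ?(subsetP sHN).
by apply/orbitP; exists (rho g); rewrite ?mem_induced.
Qed.

End Induced.

(** * Orbits of a normal subgroup *)

(** An element of [X] moving [x] to [y] maps the [N]-orbit of [x] onto the orbit of [y] under a
    conjugate of [N], which is [N] itself. *)
Lemma card_orbit_normal (aT : finGroupType) (rT : finType)
    (to : {action aT &-> rT}) (S : {set rT}) (N X : {group aT}) :
    X \subset 'N(N) -> [transitive X, on S | to] ->
  {in S &, forall x y, #|orbit to N x| = #|orbit to N y|}.
Proof.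
move=> nNX trX x y Sx Sy; have [a Xa ->] := atransP2 trX Sx Sy.
by rewrite -{2}(normsP nNX a Xa) -setact_orbit card_setact.
Qed.

Lemma dvdn_card_orbits (aT : finGroupType) (rT : finType)
    (to : {action aT &-> rT}) (S : {set rT}) (N : {group aT}) a :
    [acts N, on S | to] -> {in S, forall x, #|orbit to N x| = a} ->
  a %| #|S|.
Proof.
move=> aNS orbN; rewrite -(acts_sum_card_orbit aNS).
by apply: dvdn_sum => _ /imsetP[x Sx ->]; rewrite orbN.
Qed.

(** * Invariant partitions *)

Section Blocks.

Variables (T : finType) (Sigma : {set {set T}}).
Hypothesis partSigma : partition Sigma [set: T].
Implicit Types (A B : {set T}) (x g : {perm T}).

Lemma block_eq A B w :
  A \in Sigma -> B \in Sigma -> w \in A -> w \in B -> A = B.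
Proof.
have tI := partition_trivIset partSigma.
by move=> SA SB Aw Bw; rewrite -(def_pblock tI SA Aw) (def_pblock tI SB Bw).
Qed.

Lemma block_neq0 A : A \in Sigma -> {w | w \in A}.
Proof.
move=> SA; apply/sigW/set0Pn; apply: contraTneq SA => ->.
by have /and3P[] := partSigma.
Qed.

Lemma mem_setactP A x w : (x w \in ('P^*)%act A x) = (w \in A).
Proof. by rewrite /= /setact mem_imset //; apply: (act_inj (perm_action T)). Qed.

Lemma setact_block A x :
  x \in 'N(Sigma | 'P^*) -> A \in Sigma -> ('P^*)%act A x \in Sigma.
Proof. by move=> nSx; rewrite (astabs_act _ nSx). Qed.

(** A permutation preserving the partition sends [A] to a part, and any one of its points determines
    a part. *)
Lemma astabs_block A x w :
    x \in 'N(Sigma | 'P^*) -> A \in Sigma -> w \in A ->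
  (x \in 'N(A | 'P)) = (x w \in A).
Proof.
move=> nSx SA Aw; apply/idP/idP => [nAx | Axw].
  by rewrite -[x w]/(('P)%act w x) (astabs_act _ nAx).
rewrite -astab1_set; apply/astab1P.
by apply: (@block_eq _ _ (x w)); rewrite ?setact_block ?mem_setactP.
Qed.

Lemma setact_block_eq A x g w :
    x \in 'N(Sigma | 'P^*) -> g \in 'N(Sigma | 'P^*) ->
    A \in Sigma -> w \in A -> x w = g w ->
  ('P^*)%act A x = ('P^*)%act A g.
Proof.
move=> nSx nSg SA Aw Exg; apply: (@block_eq _ _ (x w)); rewrite ?setact_block //.
  by rewrite mem_setactP.
by rewrite Exg mem_setactP.
Qed.

Lemma astabs_astab A x :
  A \in Sigma -> x \in 'C(Sigma | 'P^*) -> x \in 'N(A | 'P).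
Proof. by move=> SA /astabP cSx; rewrite -astab1_set; apply/astab1P/cSx. Qed.

(** Fix [w0] in [A] and [g0] agreeing with [x] there. For every [w] in [A], an element agreeing with
    [x] at both [w0] and [w] moves [A] to the same part as [g0], so [x] maps all of [A] into that
    one part. *)
Lemma two_closure_blocks (G : {group {perm T}}) :
  [acts G, on Sigma | 'P^*] -> [acts two_closure G, on Sigma | 'P^*].
Proof.
move=> aGS; apply/subsetP=> x /two_closureP cGx.
rewrite !inE; apply/subsetP=> A SA; rewrite inE.
have [w0 Aw0] := block_neq0 SA; have [g0 Gg0 [Eg0 _]] := cGx w0 w0.
suff -> : ('P^*)%act A x = ('P^*)%act A g0.
  by rewrite setact_block ?(subsetP aGS).
apply/eqP; rewrite eqEcard !card_setact leqnn andbT.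
apply/subsetP=> _ /imsetP[w Aw ->]; have [g Gg [Eg0' Eg]] := cGx w0 w.
rewrite [('P)%act w x]Eg.
rewrite (@setact_block_eq A g0 g w0) ?(subsetP aGS) -?Eg0 //.
by rewrite mem_setactP.
Qed.

End Blocks.

(** * Coordinates and elements of the base group *)

Section Coordinates.

Variables (Omega : finType) (Sigma : {set {set Omega}}) (Delta : {set Omega}).
Hypothesis partSigma : partition Sigma [set: Omega].
Variable c : coordinates Sigma Delta.
Local Notation D := {x | x \in Delta}.
Local Notation I := {A | A \in Sigma}.
Implicit Types (i : I) (d : D) (x y : {ffun I -> {perm D}}).

Lemma coord_of_block w i : w \in val i -> (coord_of c w).2 = i.
Proof.
move=> iw; apply: val_inj.
exact: (block_eq partSigma (valP _) (valP _) (coord_block c w) iw).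
Qed.

Lemma of_coord_block d i : of_coord c (d, i) \in val i.
Proof. by have := coord_block c (of_coord c (d, i)); rewrite of_coordK. Qed.

Lemma of_coord_Delta d i : val i = Delta -> of_coord c (d, i) = val d.
Proof.
move=> Ei; rewrite -[RHS](coord_ofK c); congr (of_coord c _).
rewrite [RHS]surjective_pairing (@coord_of_block _ i) ?Ei ?(valP d) //.
by congr (_, _); apply: val_inj; rewrite coord_Delta ?(valP d).
Qed.

Lemma base_eltE x d i : base_elt c x (of_coord c (d, i)) = of_coord c (x i d, i).
Proof. by rewrite permE /base_fun of_coordK. Qed.

Lemma top_eltE sigma d i :
  top_elt c sigma (of_coord c (d, i)) = of_coord c (d, sigma i).
Proof. by rewrite permE /top_fun of_coordK. Qed.

Lemma base_elt_astab x : base_elt c x \in 'C(Sigma | 'P^*).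
Proof.
apply/astabP=> A SA; apply/eqP; rewrite eqEcard card_setact leqnn andbT.
apply/subsetP=> _ /imsetP[w Aw ->].
rewrite -[w](coord_ofK c) [coord_of c w]surjective_pairing.
by rewrite (@coord_of_block w (exist _ A SA)) //= apermE base_eltE of_coord_block.
Qed.

(** A permutation fixing every part keeps second coordinates, so on the part [i] it is given by an
    injection [f i] of first coordinates. *)
Lemma astab_base_elt (n : {perm Omega}) :
  n \in 'C(Sigma | 'P^*) -> {x | n = base_elt c x}.
Proof.
move=> cSn.
have nP d i : (coord_of c (n (of_coord c (d, i)))).2 = i.
  apply: coord_of_block; have nin := astabs_astab (valP i) cSn.
  by have := astabs_act (of_coord c (d, i)) nin; rewrite of_coord_block => ->.
pose f i d := (coord_of c (n (of_coord c (d, i)))).1.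
have fP d i : n (of_coord c (d, i)) = of_coord c (f i d, i).
  by rewrite -[LHS](coord_ofK c) [coord_of c (n _)]surjective_pairing nP.
have f_inj i : injective (f i).
  move=> d e Ef; have /perm_inj/(can_inj (of_coordK c))[] //:
    n (of_coord c (d, i)) = n (of_coord c (e, i)) by rewrite !fP Ef.
exists [ffun i => perm (f_inj i)]; apply/permP=> w.
rewrite -[w](coord_ofK c) [coord_of c w]surjective_pairing.
by rewrite base_eltE fP ffunE permE.
Qed.

(** Evaluate both orders of the product at the point with coordinates [(d, i)]. This carries
    information on one coordinate of a normalised subgroup to another coordinate. *)
Lemma base_elt_conj x x' y sigma i :
    base_elt c x' = base_elt c x ^ (base_elt c y * top_elt c sigma) ->
  x' (sigma i) = x i ^ y i.
Proof.
move=> Ex'; apply: (mulgI (y i)); rewrite -conjgC; apply/permP=> d.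
have: (base_elt c x * (base_elt c y * top_elt c sigma)) (of_coord c (d, i)) =
      (base_elt c y * top_elt c sigma * base_elt c x') (of_coord c (d, i)).
  by rewrite Ex' -conjgC.
rewrite !permM !(base_eltE, top_eltE).
by move/(can_inj (of_coordK c)) => [].
Qed.

Lemma base_elt_Delta x i d :
  val i = Delta -> val (x i d) = base_elt c x (val d).
Proof. by move=> Ei; rewrite -!(of_coord_Delta _ Ei) base_eltE. Qed.

End Coordinates.

(** * The kernel of the 2-closure on the partition *)

Section TwoClosure.

Variables (Omega : finType) (G : {group {perm Omega}}).
Variables (Sigma : {set {set Omega}}) (Delta : {set Omega}).
Hypothesis transG : [transitive G, on [set: Omega] | 'P].
Hypothesis partSigma : partition Sigma [set: Omega].
Hypothesis invSigma : [acts G, on Sigma | 'P^*].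
Hypothesis SigmaDelta : Delta \in Sigma.
Hypothesis coreM : gcore 'N_G(Delta | 'P) G = 1.

Local Notation L := (induced 'P^* Sigma G).
Local Notation X := (two_closure G).
Local Notation N := 'C_X(Sigma | 'P^*).
Local Notation M A := 'N_G(A | 'P).

Lemma transitive_elt u v : exists2 g, g \in G & g u = v.
Proof. by have [g Gg ->] := atransP2 transG (in_setT u) (in_setT v); exists g. Qed.

Lemma mem_stab_blocks A B (g : {perm Omega}) :
  (g \in M A :&: M B) = [&& g \in G, g \in 'N(A | 'P) & g \in 'N(B | 'P)].
Proof.
apply/setIP/and3P => [[/setIP[-> ->] /setIP[_ ->]] | [Gg nA nB]] //.
by split; apply/setIP.
Qed.

(** This kernel is normal in [G] and stabilises [Delta], so it lies in the core of [M Delta]. *)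
Lemma astab_blocks_trivial : 'C_G(Sigma | 'P^*) = 1.
Proof.
apply/trivgP; rewrite -coreM; apply: gcore_max.
  by rewrite setIS //; apply/subsetP=> g; apply: astabs_astab.
by rewrite normsI ?normG // (subset_trans invSigma) ?astab_norm.
Qed.

Lemma kernel_norm : X \subset 'N(N).
Proof.
rewrite normsI ?normG // (subset_trans _ (astab_norm _ _)) //.
exact: two_closure_blocks.
Qed.

Lemma kernel_orbit_card (w v : Omega) : #|orbit 'P N w| = #|orbit 'P N v|.
Proof.
apply: (card_orbit_normal kernel_norm) (in_setT w) (in_setT v).
have sGX := sub_two_closure G.
apply/imsetP; exists w => //; apply/esym/setP=> u; rewrite inE.
have [g Gg <-] := transitive_elt w u.
by apply/orbitP; exists g => //; apply: (subsetP sGX).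
Qed.

(** Take [g] in [G] agreeing with [x] at [w] and at some point of [B]; these two points already
    force [g] to stabilise both parts, because [x] does. *)
Lemma two_closure_block_orbit A B w x :
    A \in Sigma -> B \in Sigma -> w \in A -> x \in X ->
    x \in 'N(A | 'P) -> x \in 'N(B | 'P) ->
  exists2 g, g \in M A :&: M B & g w = x w.
Proof.
move=> SA SB Aw Xx nAx nBx; have [v Bv] := block_neq0 partSigma SB.
have nSx := subsetP (two_closure_blocks partSigma invSigma) x Xx.
have [g Gg [Ew Ev]] := two_closureP _ _ Xx w v.
exists g => //; have nSg := subsetP invSigma g Gg; rewrite mem_stab_blocks Gg.
rewrite (astabs_block partSigma nSg SA Aw) (astabs_block partSigma nSg SB Bv).
rewrite -Ew -Ev -(astabs_block partSigma nSx SA Aw).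
by rewrite -(astabs_block partSigma nSx SB Bv) nAx nBx.
Qed.

(** As [A] is a block of a transitive group, [M A] is transitive on [A], and a subgroup of it
    supplements a point stabiliser exactly when it is itself transitive on [A]. *)
Lemma stab_factorization A B alpha :
    A \in Sigma -> alpha \in A ->
  (M A :&: M B) * 'C_G[alpha | 'P] = M A <->
  (forall w, w \in A -> exists2 g, g \in M A :&: M B & g alpha = w).
Proof.
move=> SA Aa; have sCM : 'C_G[alpha | 'P] \subset M A.
  apply/subsetP=> g /setIP[Gg /astab1P ga]; rewrite inE Gg.
  rewrite (astabs_block partSigma (subsetP invSigma g Gg) SA Aa).
  by rewrite -[g _]/('P%act alpha g) ga.
split=> [defM w Aw | tr].
  (* Products act from left to right: in [m = h * k] the factor [k] fixes [alpha], so if [m] sends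
     [w] to [alpha], then [h] already does. *)
  have [m Gm mw] := transitive_elt w alpha.
  have MAm : m \in M A.
    by rewrite inE Gm (astabs_block partSigma (subsetP invSigma m Gm) SA Aw) mw.
  move: MAm; rewrite -{1}defM => /mulsgP[h k Mh /setIP[_ /astab1P ka] Em].
  exists h^-1; first exact: groupVr.
  apply: (canLR (permK h)); apply: (@perm_inj _ k).
  by rewrite -[LHS]/('P%act alpha k) ka -permM -Em mw.
apply/eqP; rewrite eqEsubset mul_subG ?subsetIl //=.
apply/subsetP=> m MAm; have /setIP[Gm nAm] := MAm.
have Aw : m^-1 alpha \in A.
  by have := astabs_act alpha (groupVr nAm); rewrite Aa => ->.
have [g Mg ga] := tr _ Aw; apply/mulsgP; exists g^-1 (g * m).
- exact: groupVr.
- rewrite inE; apply/andP; split.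
    by case/setIP: Mg => /setIP[Gg _] _; rewrite groupM.
  by apply/astab1P; rewrite /= apermE permM ga permKV.
- by rewrite mulKg.
Qed.

Lemma card_block A : A \in Sigma -> #|A| = #|Delta|.
Proof.
move=> SA; have [w Aw] := block_neq0 partSigma SA.
have [d Dd] := block_neq0 partSigma SigmaDelta.
have [g Gg gd] := transitive_elt w d.
have nSg := subsetP invSigma g Gg.
rewrite -(card_setact 'P A g).
rewrite (block_eq partSigma (setact_block nSg SA) SigmaDelta _ Dd) //.
by rewrite -gd mem_setactP.
Qed.

Lemma kernel_orbit_dvdn A B w :
  A \in Sigma -> B \in Sigma -> #|orbit 'P N w| %| #|M A :&: M B|.
Proof.
move=> SA SB; have [v Av] := block_neq0 partSigma SA.
apply: dvdn_trans (dvdn_orbit 'P [group of M A :&: M B] v).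
apply: dvdn_card_orbits => [|u _]; last exact: kernel_orbit_card.
(* The orbit of [v] is [N]-invariant: it lies in [A], and at each of its points [n] agrees with an
   element of [M A :&: M B]. *)
apply/subsetP=> n /setIP[Xn cSn]; rewrite !inE.
apply/subsetP=> _ /orbitP[h Mh <-]; rewrite inE.
have /setIP[/setIP[_ nAh] _] := Mh.
have Ahv : h v \in A by have := astabs_act v nAh; rewrite Av.
have [g Mg Eg] :=
  two_closure_block_orbit SA SB Ahv Xn (astabs_astab SA cSn) (astabs_astab SB cSn).
apply/orbitP; exists (h * g); first exact: groupM.
by rewrite /= !apermE permM Eg.
Qed.

Lemma kernel_orbit_Delta_dvdn w : #|orbit 'P N w| %| #|Delta|.
Proof.
apply: dvdn_card_orbits => [|u _]; last exact: kernel_orbit_card.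
by apply/subsetP=> n /setIP[_ cSn]; apply: (astabs_astab SigmaDelta cSn).
Qed.

(** All [N]-orbits have the same length, so one trivial orbit makes [N] fix every point. *)
Lemma kernel_orbit1 w : #|orbit 'P N w| = 1%N -> N = 1.
Proof.
move=> orb1; apply/trivgP/subsetP=> n Nn; rewrite inE; apply/eqP/permP=> u.
have /eqP/cards1P[v defv] := etrans (kernel_orbit_card u w) orb1.
have := mem_orbit 'P u Nn; have := orbit_refl 'P N u.
by rewrite defv !inE => /eqP-> /eqP; rewrite perm1.
Qed.

(** Since only the identity of [G] fixes all parts, passing to the action on parts is injective and
    matches the two stabilisers. *)
Lemma card_stab_blocks (i j : {B : {set Omega} | B \in Sigma}) :
  #|'C_L[i | 'P] :&: 'C_L[j | 'P]| = #|M (val i) :&: M (val j)|.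
Proof.
pose rho := actperm (subaction {B : {set Omega} | B \in Sigma} ('P^*)%act).
have rhoE g k : g \in G -> val (rho g k) = ('P^*)%act (val k) g.
  by move=> Gg; apply: val_actperm_sub; apply: (subsetP invSigma).
rewrite -(@card_in_imset _ _ rho) => [|g h]; last first.
  case/setIP=> /setIP[Gg _] _ /setIP[/setIP[Gh _] _] Egh.
  apply/eqP; rewrite eq_mulgV1; apply/eqP/set1gP; rewrite -astab_blocks_trivial.
  rewrite inE groupM ?groupV //; apply/astabP=> A SA.
  have := rhoE g (exist _ A SA) Gg; rewrite Egh rhoE //= => Eh.
  by rewrite actM -[X in _ X _ = _]Eh actK.
have stabE g k : g \in G -> (g \in 'N(val k | 'P)) = (rho g k == k).
  move=> Gg; rewrite -val_eqE rhoE // -astab1_set.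
  by apply/astab1P/eqP.
apply: eq_card => r; apply/setIP/imsetP => [[] | [g]].
  case/setIP=> /(inducedP _ invSigma)[g Gg rE] /astab1P ri /setIP[_ /astab1P rj].
  have Er : r = rho g by apply/permP=> k; apply: val_inj; rewrite rE rhoE.
  exists g => //; rewrite mem_stab_blocks Gg !stabE // -Er.
  by apply/and3P; split=> //; apply/eqP.
rewrite mem_stab_blocks => /and3P[Gg]; rewrite !stabE // => /eqP ri /eqP rj ->.
by split; rewrite inE mem_induced //; apply/astab1P.
Qed.

(** * The splitting of the 2-closure over [G] *)

Hypothesis closedL : two_closure L = L.

Lemma kernel_sdprod : N ><| G = X.
Proof.
have sGX := sub_two_closure G; have aXS := two_closure_blocks partSigma invSigma.
rewrite sdprodE; first 1 last.
- exact: subset_trans sGX kernel_norm.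
- by rewrite setIAC (setIidPr sGX) astab_blocks_trivial.
apply/eqP; rewrite eqEsubset mul_subG ?subsetIl //=; apply/subsetP=> x Xx.
pose rho := actperm (subaction {B : {set Omega} | B \in Sigma} ('P^*)%act).
(* An element of [G] agreeing with [x] at a point of [i] and a point of [j] moves both parts as [x]
   does. *)
have: rho x \in L.
  rewrite -closedL; apply/two_closureP=> i j.
  have [u iu] := block_neq0 partSigma (valP i).
  have [v jv] := block_neq0 partSigma (valP j).
  have [g Gg [Eu Ev]] := two_closureP _ _ Xx u v.
  have [nSx nSg] := (subsetP aXS x Xx, subsetP invSigma g Gg).
  exists (rho g); first exact: mem_induced.
  by split; apply: val_inj; rewrite !val_actperm_sub //;
    [apply: (setact_block_eq partSigma _ _ _ iu)
    | apply: (setact_block_eq partSigma _ _ _ jv)];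
    rewrite ?(valP i) ?(valP j).
case/(inducedP _ invSigma)=> g Gg Exg; apply/mulsgP.
(* As [g] acts on the parts like [x], the quotient [x * g^-1] lies in the kernel. *)
exists (x * g^-1) g; rewrite ?mulgKV //.
apply/setIP; split; first by rewrite groupM // groupV (subsetP sGX).
apply/astabP=> A SA.
have := Exg (exist _ A SA); rewrite val_actperm_sub ?(subsetP aXS) //= => Eg.
by rewrite actM [X in _ X _ = _]Eg actK.
Qed.

Lemma kernel_neq1 : X <> G -> N != 1.
Proof.
move=> neqXG; apply/eqP=> N1; apply: neqXG; apply: val_inj.
by rewrite /= -kernel_sdprod N1 sdprod1g.
Qed.

Lemma prime_block_factorization :
    prime #|Delta| -> X <> G -> forall A B, A \in Sigma -> B \in Sigma ->
  forall alpha, alpha \in A -> (M A :&: M B) * 'C_G[alpha | 'P] = M A.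
Proof.
move=> prD neqXG A B SA SB alpha Aa; apply/stab_factorization=> // w Aw.
have cardA := card_block SA.
have /primeP[_ prD2] := prD.
(* The orbit length divides a prime, and length 1 would give [N = 1] and hence [X = G]. *)
have orbA : orbit 'P N alpha = A.
  apply/eqP; rewrite eqEcard; apply/andP; split.
    apply/subsetP=> _ /orbitP[n /setIP[_ cSn] <-].
    by rewrite (astabs_act _ (astabs_astab SA cSn)).
  rewrite cardA; have /orP[/eqP/kernel_orbit1 N1 | /eqP-> //] :=
    prD2 _ (kernel_orbit_Delta_dvdn alpha).
  by have := kernel_neq1 neqXG; rewrite N1 eqxx.
move: Aw; rewrite -{1}orbA => /orbitP[n /setIP[Xn cSn] <-].
exact: two_closure_block_orbit (astabs_astab SA cSn) (astabs_astab SB cSn).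
Qed.

Lemma kernel_induced_normal :
  induced 'P Delta N <| induced 'P Delta 'N_X(Delta | 'P).
Proof.
apply: morphim_normal; apply/andP; split.
  rewrite subsetI subsetIl /=; apply/subsetP=> n /setIP[_].
  exact: astabs_astab.
exact: subset_trans (subsetIl _ _) kernel_norm.
Qed.

(** * Coordinate projections of the kernel *)

Section Wreath.

Variable c : coordinates Sigma Delta.
Hypothesis wreathG : G \subset wreath c (induced 'P Delta (M Delta)) L.

(** On the coordinate [Delta] the projection is the induced group [A]. To reach the coordinate [i],
    conjugate by some [g] in [G] moving [Delta] to [i]: this preserves [N] and conjugates the
    projection by a component of [g], which normalises [A]. *)
Lemma kernel_subdirect : subdirect c N (induced 'P Delta N).
Proof.
set A := induced 'P Delta N; pose D : {B | B \in Sigma} := exist _ Delta SigmaDelta.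
have sND : N \subset 'N(Delta | 'P).
  by apply/subsetP=> n /setIP[_]; apply: astabs_astab.
have projD x : base_elt c x \in N -> x D \in A.
  move=> Nx; apply/inducedP=> //; exists (base_elt c x) => // u.
  exact: base_elt_Delta.
have liftD r : r \in A -> exists2 x, base_elt c x \in N & x D = r.
  case/(inducedP _ sND)=> n Nn rE; have /setIP[_ cSn] := Nn.
  have [x Ex] := astab_base_elt partSigma c cSn.
  exists x; rewrite -?Ex //; apply/permP=> u; apply: val_inj.
  by rewrite (base_elt_Delta partSigma c) // -Ex rE.
have proj i : [set x i | x : {ffun _ -> _} & base_elt c x \in N] = A.
  have [d Dd] := block_neq0 partSigma SigmaDelta.
  have [w iw] := block_neq0 partSigma (valP i).
  have [g Gg gd] := transitive_elt d w.
  have /mulsgP[_ _ /imsetP[y /ffun_onP Ry ->] /imsetP[sigma _ ->] Eg] :=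
    subsetP wreathG g Gg.
  (* Compare the second coordinates of [g d] and [w]. *)
  have sDi : sigma D = i.
    move: iw; rewrite -gd Eg => /(coord_of_block partSigma c) <-.
    have /= <- := of_coord_Delta partSigma c (exist _ d Dd) (erefl : val D = Delta).
    by rewrite permM base_eltE top_eltE of_coordK.
  (* The component [y D] is induced by [M Delta], hence by the stabiliser of [Delta] in [X], and the
     group induced by the latter normalises [A]. *)
  have nAy : y D \in 'N(A).
    have /andP[_ /subsetP nAY] := kernel_induced_normal; apply: nAY.
    apply: (subsetP _ _ (Ry D)); apply: morphimS.
    by rewrite setSI ?sub_two_closure.
  have nNg : g \in 'N(N).
    by rewrite (subsetP kernel_norm) ?(subsetP (sub_two_closure G)).
  apply/setP=> r; apply/imsetP/idP => [[x'] | Ar].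
    rewrite inE => Nx' ->.
    have Nx : base_elt c x' ^ g^-1 \in N by rewrite memJ_norm ?groupV.
    have /setIP[_ cSx] := Nx; have [x Ex] := astab_base_elt partSigma c cSx.
    rewrite -sDi (@base_elt_conj _ _ _ c x x' y) -?Eg -?Ex ?conjgKV //.
    by rewrite memJ_norm // projD // -Ex.
  have [x Nx Ex] : exists2 x, base_elt c x \in N & x D = r ^ (y D)^-1.
    by apply: liftD; rewrite memJ_norm ?groupV.
  have Nx' : base_elt c x ^ g \in N by rewrite memJ_norm.
  have /setIP[_ cSx'] := Nx'; have [x' Ex'] := astab_base_elt partSigma c cSx'.
  exists x'; first by rewrite inE -Ex'.
  by rewrite -sDi (@base_elt_conj _ _ _ c x x' y) -?Eg -?Ex' // Ex conjgKV.
split=> //; apply/subsetP=> n Nn; have /setIP[_ cSn] := Nn.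
have [x Ex] := astab_base_elt partSigma c cSn; apply/imsetP; exists x => //.
by apply/ffun_onP=> i; rewrite -(proj i); apply/imsetP; exists x; rewrite // inE -Ex.
Qed.

(** A base element fixes every part, so lying in [G] would make it trivial, against [r != 1]. *)
Lemma two_closure_neq (r : {perm {x | x \in Delta}}) :
  r != 1 -> base_elt c [ffun=> r] \in X -> X <> G.
Proof.
move=> r1 Xz XG; case/eqP: r1; pose D : {B | B \in Sigma} := exist _ Delta SigmaDelta.
have /set1gP z1 : base_elt c [ffun=> r] \in [1 {perm Omega}].
  by rewrite -astab_blocks_trivial; apply/setIP; rewrite -{1}XG base_elt_astab.
apply/permP=> d; apply: val_inj.
have := base_elt_Delta partSigma c [ffun=> r] d (erefl : val D = Delta).
by rewrite ffunE z1 !perm1.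
Qed.

End Wreath.

(** * Blocks of size two *)

Section BlocksOfSize2.

Hypothesis Delta2 : #|Delta| = 2.
Local Notation R := (induced 'P Delta (M Delta)).

Lemma card_sub_Delta2 : #|{: {x | x \in Delta}}| = 2.
Proof. by rewrite card_sig -Delta2; apply: eq_card. Qed.

Lemma induced_Delta2_neq1 : exists2 r, r \in R & r != 1.
Proof.
have /eqP/cards2P[d [e [dne DE]]] := Delta2.
have [Dd De] : d \in Delta /\ e \in Delta by rewrite DE !inE !eqxx orbT.
have [g Gg gd] := transitive_elt d e.
have Mg : g \in M Delta.
  apply/setIP; rewrite Gg.
  by rewrite (astabs_block partSigma (subsetP invSigma g Gg) SigmaDelta Dd) gd.
exists (actperm (subaction {x | x \in Delta} 'P) g).
  by apply: mem_induced; rewrite ?subsetIr.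
apply: contraNneq dne => r1.
have := val_actperm_sub (exist _ d Dd : {x | x \in Delta})
  (subsetP (subsetIr _ _) g Mg).
by rewrite r1 perm1 /= apermE gd => <-.
Qed.

Lemma induced_Delta2 : R \isog Zp 2.
Proof.
have R2 : #|R| = 2.
  apply/eqP; rewrite eqn_leq; apply/andP; split.
    rewrite -[2]/(2`!) -card_sub_Delta2 -cardsT -card_perm; apply: subset_leq_card.
    by apply/subsetP=> r _; rewrite unfold_in; apply/subsetP=> u; rewrite inE.
  rewrite cardG_gt1; have [r Rr] := induced_Delta2_neq1.
  by apply: contraNneq => R1; apply/eqP/set1gP; rewrite -R1.
by rewrite isog_cyclic_card ?prime_cyclic ?R2 // card_Zp //= Zp_cyclic.
Qed.

(** Here [z] swaps the two points of every part. For [u] in [A] and [v] in [B], the factorisations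
    give [g] and [h] in [M A :&: M B] agreeing with [z] at [u] and at [v] respectively; one of [g],
    [h], [g * h] then agrees with [z] at both. *)
Lemma constant_base_elt_mem (c : coordinates Sigma Delta)
    (r : {perm {x | x \in Delta}}) :
    (forall A B, A \in Sigma -> B \in Sigma ->
     forall alpha, alpha \in A -> (M A :&: M B) * 'C_G[alpha | 'P] = M A) ->
  r != 1 -> base_elt c [ffun=> r] \in X.
Proof.
move=> factM r1; set z := base_elt c _.
(* If [r] fixed [d] and moved [e], then [d], [e], [r e] would be three distinct points of
   [Delta]. *)
have rD d : r d != d.
  apply: contraNneq r1 => rd; apply/eqP/permP=> e; rewrite perm1.
  have [-> // | ned] := eqVneq e d.
  apply/eqP; apply: contraT => nre.
  have uq : uniq [:: d; e; r e].
    rewrite /= !inE negb_or eq_sym ned [e == _]eq_sym nre !andbT /=.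
    by rewrite -{1}rd (inj_eq perm_inj) eq_sym.
  by have := max_card (mem [:: d; e; r e]); rewrite (card_uniqP uq) card_sub_Delta2.
have zN w : z w != w.
  rewrite -[w](coord_ofK c) [coord_of c w]surjective_pairing base_eltE ffunE.
  by rewrite (inj_eq (can_inj (of_coordK c))) xpair_eqE eqxx andbT.
have zA A w : A \in Sigma -> w \in A -> z w \in A.
  move=> SA Aw; have nAz := astabs_astab SA (base_elt_astab partSigma c [ffun=> r]).
  by have := astabs_act w nAz; rewrite Aw.
have zP A u w : A \in Sigma -> u \in A -> w \in A -> w != u -> w = z u.
  move=> SA Au Aw nwu; have /eqP := card_block SA.
  rewrite Delta2 => /cards2P[a [b [_ AE]]].
  have := zN u; have := zA A u SA Au; move: Au Aw nwu; rewrite AE !inE.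
  by do 2![case/pred2P=> ->]; rewrite ?eqxx // => _ /pred2P[]->; rewrite ?eqxx.
have tr A B w : A \in Sigma -> B \in Sigma -> w \in A ->
    exists2 g, g \in M A :&: M B & g w = z w.
  move=> SA SB Aw; have /stab_factorization := factM A B SA SB w Aw.
  by apply=> //; apply: zA.
have coverS := cover_partition partSigma.
have inB w : (pblock Sigma w \in Sigma) * (w \in pblock Sigma w).
  by rewrite pblock_mem ?mem_pblock coverS inE.
apply/two_closureP=> u v; have [SA Au] := inB u; have [SB Bv] := inB v.
have [g Mg gu] := tr _ _ u SA SB Au; have [h Mh hv] := tr _ _ v SB SA Bv.
move: Mg Mh; rewrite !mem_stab_blocks => /and3P[Gg nAg nBg] /and3P[Gh nBh nAh].
have [gv | ngv] := eqVneq (g v) v; last first.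
  exists g => //; split=> //; apply/esym/(zP _ v _ SB Bv) => //.
  by have := astabs_act v nBg; rewrite Bv.
have [hu | nhu] := eqVneq (h u) u; last first.
  exists h => //; split=> //; apply/esym/(zP _ u _ SA Au) => //.
  by have := astabs_act u nAh; rewrite Au.
(* g swaps the first block and fixes the second, h does the opposite *)
exists (g * h); first exact: groupM.
rewrite !permM gu gv hv; split=> //; apply/esym/(zP _ u _ SA Au).
  by have := astabs_act (z u) nAh; rewrite zA.
by rewrite -{2}hu (inj_eq perm_inj).
Qed.

End BlocksOfSize2.

End TwoClosure.

(** * The four assertions, deduced from the kernel *)

Theorem proposition3p10
    (Omega : finType) (G : {group {perm Omega}})
    (Sigma : {set {set Omega}}) (Delta : {set Omega})
    (transG : [transitive G, on [set: Omega] | 'P])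
    (partSigma : partition Sigma [set: Omega])
    (invSigma : [acts G, on Sigma | 'P^*])
    (ntSigma : 1 < #|Sigma| < #|Omega|)
    (SigmaDelta : Delta \in Sigma)
    (coreM : gcore 'N_G(Delta | 'P) G = 1)
    (c : coordinates Sigma Delta)
    (wreathG : G \subset
       wreath c (induced 'P Delta 'N_G(Delta | 'P)) (induced 'P^* Sigma G))
    (closedL : two_closure (induced 'P^* Sigma G) = induced 'P^* Sigma G) :
  let L := induced 'P^* Sigma G in
  let R := induced 'P Delta 'N_G(Delta | 'P) in
  let X := two_closure G in
  let Y := induced 'P Delta 'N_X(Delta | 'P) in
  let M := fun A : {set Omega} => 'N_G(A | 'P) in
  let factM := forall A B : {set Omega}, A \in Sigma -> B \in Sigma ->
    forall alpha, alpha \in A -> (M A :&: M B) * 'C_G[alpha | 'P] = M A in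
  [/\ #|Delta| = 2 ->
        [/\ R \isog Zp 2,
            X <> G <-> factM
          & X <> G <->
            exists r, [/\ r \in R, r != 1 & base_elt c [ffun=> r] \in X]],
      X <> G ->
        exists (N : {group {perm Omega}})
               (A : {group {perm {x : Omega | x \in Delta}}}),
          [/\ N ><| G = X, subdirect c N A, A :!=: 1, A <| Y
            & exists a : nat,
                (forall x, #|orbit 'P A x| = a) /\
                (forall i j : {B : {set Omega} | B \in Sigma}, i != j ->
                   a %| #|'C_L[i | 'P] :&: 'C_L[j | 'P]|)],
      base_size L = 2 -> X = G
    & forall p : nat, prime p -> #|Delta| = p -> X <> G -> factM].
Proof.
move=> L R X Y M factM.
have sdNG := kernel_sdprod partSigma invSigma SigmaDelta coreM closedL.
have [d Dd] := block_neq0 partSigma SigmaDelta.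
have prime_fact p : prime p -> #|Delta| = p -> X <> G -> factM.
  move=> pr_p Dp; rewrite -Dp in pr_p.
  exact: (prime_block_factorization transG partSigma invSigma SigmaDelta coreM).
have stab_dvdn (i j : {B : {set Omega} | B \in Sigma}) :
    #|orbit 'P 'C_X(Sigma | 'P^*) d| %| #|'C_L[i | 'P] :&: 'C_L[j | 'P]|.
  rewrite (card_stab_blocks invSigma SigmaDelta coreM).
  exact: (kernel_orbit_dvdn transG partSigma invSigma _ (valP i) (valP j)).
split=> //.
- move=> D2.
  have [r Rr r1] := induced_Delta2_neq1 transG partSigma invSigma SigmaDelta D2.
  (* The prime case with [p = 2] takes (i) to (ii), [z_mem] takes (ii) to (iii), and [neqXG] takes
     (iii) to (i). *)
  have z_mem := constant_base_elt_mem transG partSigma invSigma SigmaDelta D2.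
  have neqXG := two_closure_neq partSigma invSigma SigmaDelta coreM.
  split; first exact: (induced_Delta2 transG partSigma invSigma SigmaDelta D2).
  + split; first exact: prime_fact D2.
    by move=> fact; apply: neqXG r1 (z_mem c r fact r1).
  + split=> [XnG | [r' [_ r'1]]]; last exact: neqXG r'1.
    by exists r; split=> //; apply: z_mem => //; apply: prime_fact D2 XnG.
- move=> neqXG; exists 'C_X(Sigma | 'P^*)%G, (induced 'P Delta 'C_X(Sigma | 'P^*)).
  have sND : 'C_X(Sigma | 'P^*) \subset 'N(Delta | 'P).
    by apply/subsetP=> n /setIP[_]; apply: astabs_astab.
  have orbA x : #|orbit 'P (induced 'P Delta 'C_X(Sigma | 'P^*)) x| =
                #|orbit 'P 'C_X(Sigma | 'P^*) d|.
    by rewrite card_orbit_induced //; apply: kernel_orbit_card.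
  split=> //.
  + exact: (kernel_subdirect transG partSigma invSigma SigmaDelta wreathG).
  + have := kernel_neq1 partSigma invSigma SigmaDelta coreM closedL neqXG.
    (* The orbits of the induced group have the length of the [N]-orbits; if it were trivial, this
       length would be 1 and [N] trivial. *)
    apply: contraNneq => A1; apply/eqP.
    apply: (@kernel_orbit1 _ _ _ transG partSigma invSigma d).
    apply/eqP; rewrite -dvdn1 -(orbA (exist _ d Dd)).
    by apply: dvdn_trans (dvdn_orbit _ _ _) _; rewrite A1 cards1.
  + exact: kernel_induced_normal.
  + by exists #|orbit 'P 'C_X(Sigma | 'P^*) d|.
- rewrite /base_size; case: arg_minnP => [|B /eqP cB _ /eqP/cards2P[i [j [_ BE]]]].
    (* The set of all parts is a base, so the minimum in [base_size] is attained at a genuine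
       base. *)
    rewrite -subG1; apply/subsetP=> r /setIP[_ /astabP rT].
    by apply/set1gP/permP=> k; rewrite perm1 -[LHS]/('P%act k r) rT ?inE.
  (* For a base formed by [i] and [j] the stabiliser of both is trivial, so the length of the
     [N]-orbits divides 1. *)
  apply/val_inj; rewrite /= -sdNG.
  rewrite (@kernel_orbit1 _ _ _ transG partSigma invSigma d) ?sdprod1g //.
  have := stab_dvdn i j; suff -> : 'C_L[i | 'P] :&: 'C_L[j | 'P] = 1.
    by rewrite cards1 dvdn1 => /eqP.
  by rewrite -setIIr -astabU -[1 in RHS]cB BE.
Qed.
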